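(* Let $E$ be an arbitrary graph and let $K$ be a field with involution $\overline{\phantom{k}}$. For $v\in E^0$ let $\mu(v)$ denote the cardinality of the set of all paths $\alpha$ in $E$ with $r(\alpha)=v$ (including the trivial path $v$). Let $\sigma=\sup\{\mu(v): v\in E^0\}$ in case this supremum is finite, and $\sigma=\omega$ otherwise. The following conditions are equivalent: (i) $L_K(E)$ is $^*$-regular. (ii) $L_K(E)$ is (von Neumann) regular and its involution is proper. (iii) $E$ is acyclic and the involution on $K$ is $n$-proper for every finite (positive integer) $n\leq\sigma$. Here $L_K(E)$ carries the involution induced from $K$.
   Context: Graphs: a (directed) graph $E=(E^0,E^1,r,s)$ consists of a set $E^0$ of vertices and a set $E^1$ of edges (no restriction on cardinalities) with maps $r,s:E^1\to E^0$ (range and source). A vertex is a sink if it emits no edges; it is an infinite emitter if $s^{-1}(v)$ is infinite. A path of length $n\ge 1$ is a sequence of edges $\mu=e_1\dots e_n$ with $r(e_i)=s(e_{i+1})$ for $i=1,\dots,n-1$; $s(\mu)=s(e_1)$, $r(\mu)=r(e_n)$. Vertices are regarded as paths of length $0$ (trivial paths). A cycle is a path $e_1\dots e_n$ ($n\ge1$) with $s(e_1)=r(e_n)$ and $s(e_i)\ne s(e_j)$ for $i\neq j$; $E$ is acyclic if it contains no cycles. Leavitt path algebra: $L_K(E)$ is the (associative, not necessarily unital) $K$-algebra generated by $E^0\cup E^1\cup\{e^*\mid e\in E^1\}$ with relations: (V) $vw=\delta_{v,w}v$ for $v,w\in E^0$; (P1) $s(e)e=er(e)=e$ for $e\in E^1$;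 (P2) $r(e)e^*=e^*s(e)=e^*$ for $e\in E^1$; (CK1) $e^*f=\delta_{e,f}r(e)$ for $e,f\in E^1$; (CK2) $v=\sum_{e\in s^{-1}(v)}ee^*$ for every $v\in E^0$ that is neither a sink nor an infinite emitter. For a path $\mu=e_1\dots e_n$, $\mu^*=e_n^*\dots e_1^*$, and $v^*=v$ for vertices; $L_K(E)$ is spanned over $K$ by the elements $pq^*$ with $p,q$ paths. It is a ring with local units (finite sums of distinct vertices). Involutions: an involution on a ring $R$ is an additive map $^*:R\to R$ with $(ab)^*=b^*a^*$ and $(a^* )^*=a$. For a positive integer $n$, it is $n$-proper if $x_1^*x_1+\dots+x_n^*x_n=0$ implies $x_1=\dots=x_n=0$ for all $x_1,\dots,x_n\in R$; proper means $1$-proper. Given an involution $\overline{\phantom{k}}$ on $K$, the induced involution on $L_K(E)$ is $\left(\sum_i k_ip_iq_i^*\right)^*=\sum_i\overline{k_i}\,q_ip_i^*$ for $k_i\in K$ and paths $p_i,q_i$. Regularity: a ring $R$ is (von Neumann) regular if for every $a\in R$ there is $b\in R$ with $aba=a$. A projection in a ring with involution is an element $p$ with $p^*=p=p^2$. A ring $R$ with involution (with local units) is $^*$-regular if every principal right ideal is generated by a projection, i.e. for every $a\in R$ there is a projection $p\in R$ with $aR=pR$. *)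

(* Defs.v *)
From HB Require Import structures.
From Stdlib Require List.
From mathcomp Require Import all_boot all_order all_algebra.
From mathcomp Require Import boolp classical_sets functions cardinality.

Set Implicit Arguments.
Unset Strict Implicit.
Unset Printing Implicit Defensive.

Import GRing.Theory.
Local Open Scope classical_set_scope.
Local Open Scope card_scope.
Local Open Scope ring_scope.

(** * Involutions and regularity

    Leavitt path algebras need not be unital, so these notions are stated for
    an additive group [R] together with a multiplication [mul]. *)

Section Involutions.
Variables (R : zmodType) (mul : R -> R -> R).
Local Notation "x ** y" := (mul x y) (at level 40, left associativity).

Definition is_involution (st : R -> R) : Prop :=
  [/\ forall a b, st (a + b) = st a + st b,
      forall a b, st (a ** b) = st b ** st a
    & forall a, st (st a) = a].

Definition n_proper (st : R -> R) (n : nat) : Prop :=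
  forall x : 'I_n -> R,
    \sum_(i < n) st (x i) ** x i = 0 -> forall i, x i = 0.

Definition proper_involution (st : R -> R) : Prop := n_proper st 1.

Definition vn_regular : Prop := forall a, exists b, a ** b ** a = a.

Definition is_projection (st : R -> R) (p : R) : Prop :=
  st p = p /\ p ** p = p.

Definition principal_right_ideal (a : R) : set R := [set a ** r | r in setT].

(* For rings with local units, [a \in aR], so that [aR] is indeed the right
   ideal generated by [a]. *)
Definition star_regular (st : R -> R) : Prop :=
  forall a, exists p, is_projection st p /\
    principal_right_ideal a = principal_right_ideal p.

End Involutions.

(** * Graphs *)

Record graph := Graph {
  vertex : Type;
  edge : Type;
  source : edge -> vertex;
  range_of : edge -> vertex
}.

Section Graphs.
Variable E : graph.

Definition out_edges (v : vertex E) : set (edge E) := [set e | source e = v].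

Definition is_sink (v : vertex E) : Prop := out_edges v = set0.

Definition infinite_emitter (v : vertex E) : Prop := infinite_set (out_edges v).

(* A path is encoded as the pair of its source [v] and its sequence of edges;
   the trivial path at [v] is [(v, [::])].  For a nonempty sequence of edges,
   [is_path] forces the first component to be the source of the first edge, so
   every path has exactly one encoding. *)
Fixpoint is_path (v : vertex E) (p : seq (edge E)) : Prop :=
  if p is e :: p' then source e = v /\ is_path (range_of e) p' else True.

Definition path_range (v : vertex E) (p : seq (edge E)) : vertex E :=
  last v (map (@range_of E) p).

Definition is_cycle (v : vertex E) (p : seq (edge E)) : Prop :=
  [/\ p <> [::], is_path v p, path_range v p = v
    & List.NoDup (map (@source E) p)].

Definition acyclic : Prop := forall v p, ~ is_cycle v p.

Definition paths_to (w : vertex E) : set (vertex E * seq (edge E)) :=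
  [set p | is_path p.1 p.2 /\ path_range p.1 p.2 = w].

(* [mu(v) <= m] for every vertex [v]. *)
Definition mu_bounded (m : nat) : Prop := forall v, paths_to v #<= `I_m.

(* The supremum of the cardinals [mu(v)]: [Some m] when it is the finite
   cardinal [m] (the least upper bound, [0] if there are no vertices), and
   [None], standing for omega, when there is no finite upper bound. *)
Definition sigma : option nat :=
  match pselect (exists m, `[< mu_bounded m >]) with
  | left bounded => Some (ex_minn bounded)
  | right _ => None
  end.

Definition le_sigma (n : nat) : Prop :=
  if sigma is Some m then (n <= m)%N else True.

End Graphs.

(** * Leavitt path algebras

    [lpa E K] is the quotient of the formal algebra expressions in the
    generators by the least congruence containing the axioms of
    (nonunital, associative) [K]-algebras and the defining relations. *)

Section LeavittPathAlgebra.
Variables (E : graph) (K : fieldType).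

Inductive term : Type :=
| Vert of vertex E
| Edge of edge E
| Ghost of edge E
| Zero
| Add of term & term
| Scale of K & term
| Mul of term & term.

Definition term_sum (s : seq term) : term := foldr Add Zero s.

Inductive lpa_eq : term -> term -> Prop :=
| lpa_refl t : lpa_eq t t
| lpa_sym t u : lpa_eq t u -> lpa_eq u t
| lpa_trans t u w : lpa_eq t u -> lpa_eq u w -> lpa_eq t w
| lpa_congD t t' u u' :
    lpa_eq t t' -> lpa_eq u u' -> lpa_eq (Add t u) (Add t' u')
| lpa_congZ k t t' : lpa_eq t t' -> lpa_eq (Scale k t) (Scale k t')
| lpa_congM t t' u u' :
    lpa_eq t t' -> lpa_eq u u' -> lpa_eq (Mul t u) (Mul t' u')
| lpa_addA t u w : lpa_eq (Add t (Add u w)) (Add (Add t u) w)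
| lpa_addC t u : lpa_eq (Add t u) (Add u t)
| lpa_add0 t : lpa_eq (Add Zero t) t
| lpa_scale0 t : lpa_eq (Scale 0 t) Zero
| lpa_scale1 t : lpa_eq (Scale 1 t) t
| lpa_scaleA k l t : lpa_eq (Scale k (Scale l t)) (Scale (k * l) t)
| lpa_scaleDr k t u :
    lpa_eq (Scale k (Add t u)) (Add (Scale k t) (Scale k u))
| lpa_scaleDl k l t :
    lpa_eq (Scale (k + l) t) (Add (Scale k t) (Scale l t))
| lpa_termMA t u w : lpa_eq (Mul t (Mul u w)) (Mul (Mul t u) w)
| lpa_termMDl t u w : lpa_eq (Mul (Add t u) w) (Add (Mul t w) (Mul u w))
| lpa_termMDr t u w : lpa_eq (Mul t (Add u w)) (Add (Mul t u) (Mul t w))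
| lpa_termZAl k t u : lpa_eq (Mul (Scale k t) u) (Scale k (Mul t u))
| lpa_termZAr k t u : lpa_eq (Mul t (Scale k u)) (Scale k (Mul t u))
| lpa_V_idem v : lpa_eq (Mul (Vert v) (Vert v)) (Vert v)
| lpa_V_orth v w : v <> w -> lpa_eq (Mul (Vert v) (Vert w)) Zero
| lpa_P1_source e : lpa_eq (Mul (Vert (source e)) (Edge e)) (Edge e)
| lpa_P1_range e : lpa_eq (Mul (Edge e) (Vert (range_of e))) (Edge e)
| lpa_P2_range e : lpa_eq (Mul (Vert (range_of e)) (Ghost e)) (Ghost e)
| lpa_P2_source e : lpa_eq (Mul (Ghost e) (Vert (source e))) (Ghost e)
| lpa_CK1_same e : lpa_eq (Mul (Ghost e) (Edge e)) (Vert (range_of e))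
| lpa_CK1_diff e f : e <> f -> lpa_eq (Mul (Ghost e) (Edge f)) Zero
(* [es] enumerates the edges emitted by [v] without repetition *)
| lpa_CK2 v es :
    ~ is_sink v -> ~ infinite_emitter v ->
    List.NoDup es -> (forall e, List.In e es <-> out_edges v e) ->
    lpa_eq (Vert v) (term_sum [seq Mul (Edge e) (Ghost e) | e <- es]).

HB.instance Definition _ := gen_eqMixin term.
HB.instance Definition _ := gen_choiceMixin term.

Definition lpa_eqb (t u : term) : bool := `[< lpa_eq t u >].

Lemma lpa_eqb_refl : reflexive lpa_eqb.
Proof. by move=> t; apply/asboolP; exact: lpa_refl. Qed.

Lemma lpa_eqb_sym : symmetric lpa_eqb.
Proof. by move=> t u; apply/asboolP/asboolP; exact: lpa_sym. Qed.

Lemma lpa_eqb_trans : transitive lpa_eqb.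
Proof.
by move=> u t w /asboolP tu /asboolP uw; apply/asboolP; exact: lpa_trans uw.
Qed.

Canonical lpa_equiv : equiv_rel term :=
  EquivRel lpa_eqb lpa_eqb_refl lpa_eqb_sym lpa_eqb_trans.

Definition lpa : Type := {eq_quot lpa_equiv}%qT.

HB.instance Definition _ := Choice.on lpa.

Definition lpa_class (t : term) : lpa := (\pi_({eq_quot lpa_equiv}) t)%qT.
Definition lpa_repr (x : lpa) : term := repr (x : {eq_quot lpa_equiv}%qT).

Lemma lpa_classP t u : lpa_class t = lpa_class u <-> lpa_eq t u.
Proof.
split=> [/eqP|tu]; first by rewrite /lpa_class eqmodE => /asboolP.
by apply/eqP; rewrite /lpa_class eqmodE; apply/asboolP.
Qed.

Lemma lpa_reprK x : lpa_class (lpa_repr x) = x.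
Proof. exact: (@reprK _ {eq_quot lpa_equiv}%qT x). Qed.

Lemma lpa_repr_class t : lpa_eq (lpa_repr (lpa_class t)) t.
Proof. by apply/lpa_classP; rewrite lpa_reprK. Qed.

Lemma lpa_ind (P : lpa -> Prop) : (forall t, P (lpa_class t)) -> forall x, P x.
Proof. by move=> PT x; rewrite -(lpa_reprK x). Qed.

Definition lpa_zero : lpa := lpa_class Zero.
Definition lpa_add (x y : lpa) : lpa :=
  lpa_class (Add (lpa_repr x) (lpa_repr y)).
Definition lpa_scale (k : K) (x : lpa) : lpa := lpa_class (Scale k (lpa_repr x)).
Definition lpa_opp (x : lpa) : lpa := lpa_scale (- 1) x.
Definition lpa_mul (x y : lpa) : lpa :=
  lpa_class (Mul (lpa_repr x) (lpa_repr y)).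

Lemma lpa_class_add t u :
  lpa_class (Add t u) = lpa_add (lpa_class t) (lpa_class u).
Proof.
by apply/lpa_classP; apply: lpa_congD; apply: lpa_sym; exact: lpa_repr_class.
Qed.

Lemma lpa_class_scale k t : lpa_class (Scale k t) = lpa_scale k (lpa_class t).
Proof.
by apply/lpa_classP; apply: lpa_congZ; apply: lpa_sym; exact: lpa_repr_class.
Qed.

Lemma lpa_classM t u :
  lpa_class (Mul t u) = lpa_mul (lpa_class t) (lpa_class u).
Proof.
by apply/lpa_classP; apply: lpa_congM; apply: lpa_sym; exact: lpa_repr_class.
Qed.

Let classE := (lpa_class_add, lpa_class_scale, lpa_classM).

Fact lpa_addrA : associative lpa_add.
Proof.
elim/lpa_ind=> t; elim/lpa_ind=> u; elim/lpa_ind=> w.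
by rewrite -!classE; apply/lpa_classP; exact: lpa_addA.
Qed.

Fact lpa_addrC : commutative lpa_add.
Proof.
elim/lpa_ind=> t; elim/lpa_ind=> u.
by rewrite -!classE; apply/lpa_classP; exact: lpa_addC.
Qed.

Fact lpa_add0r : left_id lpa_zero lpa_add.
Proof.
elim/lpa_ind=> t.
by rewrite /lpa_zero -!classE; apply/lpa_classP; exact: lpa_add0.
Qed.

Fact lpa_addNr : left_inverse lpa_zero lpa_opp lpa_add.
Proof.
elim/lpa_ind=> t; rewrite /lpa_opp /lpa_zero -!classE; apply/lpa_classP.
apply: lpa_trans (lpa_scale0 t).
apply: lpa_trans (lpa_congD (lpa_refl _) (lpa_sym (lpa_scale1 t))) _.
by have := lpa_scaleDl (- 1) 1 t; rewrite addNr => /lpa_sym.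
Qed.

HB.instance Definition _ :=
  GRing.isZmodule.Build lpa lpa_addrA lpa_addrC lpa_add0r lpa_addNr.

Fact lpa_scalerA k l (x : lpa) :
  lpa_scale k (lpa_scale l x) = lpa_scale (k * l) x.
Proof.
elim/lpa_ind: x => t.
by rewrite -!classE; apply/lpa_classP; exact: lpa_scaleA.
Qed.

Fact lpa_scale1r : left_id 1 lpa_scale.
Proof.
by elim/lpa_ind=> t; rewrite -!classE; apply/lpa_classP; exact: lpa_scale1.
Qed.

Fact lpa_scalerDr : right_distributive lpa_scale +%R.
Proof.
move=> k; elim/lpa_ind=> t; elim/lpa_ind=> u.
rewrite -[LHS]/(lpa_scale k (lpa_add _ _)) -[RHS]/(lpa_add _ _) -!classE.
by apply/lpa_classP; exact: lpa_scaleDr.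
Qed.

Fact lpa_scalerDl (x : lpa) : {morph lpa_scale^~ x : k l / k + l}.
Proof.
move=> k l; elim/lpa_ind: x => t.
rewrite -[RHS]/(lpa_add _ _) -!classE.
by apply/lpa_classP; exact: lpa_scaleDl.
Qed.

HB.instance Definition _ := GRing.Zmodule_isLmodule.Build K lpa
  lpa_scalerA lpa_scale1r lpa_scalerDr lpa_scalerDl.

Lemma lpa_class0 : lpa_class Zero = 0.
Proof. by []. Qed.

Lemma lpa_classD t u : lpa_class (Add t u) = lpa_class t + lpa_class u.
Proof. exact: lpa_class_add. Qed.

Lemma lpa_classZ k t : lpa_class (Scale k t) = k *: lpa_class t.
Proof. exact: lpa_class_scale. Qed.

Lemma lpa_class_sum s :
  lpa_class (term_sum s) = \sum_(t <- s) lpa_class t.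
Proof.
by elim: s => [|t s IHs]; rewrite ?big_nil// big_cons -IHs -lpa_classD.
Qed.

Let lpaE := (lpa_classD, lpa_classZ, lpa_classM).

Lemma lpa_mulA : associative lpa_mul.
Proof.
elim/lpa_ind=> t; elim/lpa_ind=> u; elim/lpa_ind=> w.
by rewrite -!lpaE; apply/lpa_classP; exact: lpa_termMA.
Qed.

Lemma lpa_mulDl : left_distributive lpa_mul +%R.
Proof.
elim/lpa_ind=> t; elim/lpa_ind=> u; elim/lpa_ind=> w.
by rewrite -!lpaE; apply/lpa_classP; exact: lpa_termMDl.
Qed.

Lemma lpa_mulDr : right_distributive lpa_mul +%R.
Proof.
elim/lpa_ind=> t; elim/lpa_ind=> u; elim/lpa_ind=> w.
by rewrite -!lpaE; apply/lpa_classP; exact: lpa_termMDr.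
Qed.

Lemma lpa_scaleAl k (x y : lpa) : lpa_mul (k *: x) y = k *: lpa_mul x y.
Proof.
elim/lpa_ind: x => t; elim/lpa_ind: y => u.
rewrite -(lpa_classZ k t) -!lpa_classM -lpa_classZ.
by apply/lpa_classP; exact: lpa_termZAl.
Qed.

Lemma lpa_scaleAr k (x y : lpa) : lpa_mul x (k *: y) = k *: lpa_mul x y.
Proof.
elim/lpa_ind: x => t; elim/lpa_ind: y => u.
rewrite -(lpa_classZ k u) -!lpa_classM -lpa_classZ.
by apply/lpa_classP; exact: lpa_termZAr.
Qed.

(** ** The induced involution *)

Variable bar : K -> K.

Fixpoint term_star (t : term) : term :=
  match t with
  | Vert v => Vert v
  | Edge e => Ghost e
  | Ghost e => Edge e
  | Zero => Zero
  | Add t u => Add (term_star t) (term_star u)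
  | Scale k t => Scale (bar k) (term_star t)
  | Mul t u => Mul (term_star u) (term_star t)
  end.

(* When [bar] is an involution of [K] this does not depend on the choice of
   representatives ([lpa_star_class]), it is an involution of [lpa]
   ([lpa_star_involution]), and it is given on linear combinations of the
   spanning elements [p q^*] by the usual formula ([lpa_star_span]). *)
Definition lpa_star (x : lpa) : lpa := lpa_class (term_star (lpa_repr x)).

Hypothesis bar_inv : is_involution *%R bar.

Let barD k l : bar (k + l) = bar k + bar l.
Proof. by case: bar_inv. Qed.

Let barM k l : bar (k * l) = bar k * bar l.
Proof. by case: bar_inv => _ -> _; rewrite mulrC. Qed.

Let barK k : bar (bar k) = k.
Proof. by case: bar_inv. Qed.

Let bar0 : bar 0 = 0.
Proof. by apply: (addrI (bar 0)); rewrite -barD !addr0. Qed.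

Let bar1 : bar 1 = 1.
Proof. by rewrite -[LHS]mulr1 -[X in _ * X]barK -barM mul1r barK. Qed.

Lemma term_star_sum s : term_star (term_sum s) = term_sum (map term_star s).
Proof. by elim: s => //= t s ->. Qed.

Lemma term_star_eq t u : lpa_eq t u -> lpa_eq (term_star t) (term_star u).
Proof.
elim=> {t u} /=; try by econstructor; eauto.
- by move=> t; rewrite bar0; constructor.
- by move=> t; rewrite bar1; constructor.
- by move=> k l t; rewrite barM; constructor.
- by move=> k l t; rewrite barD; constructor.
- by move=> t u w; apply/lpa_sym/lpa_termMA.
- move=> v es vs vi nes esP; rewrite term_star_sum -map_comp /=.
  exact: lpa_CK2.
Qed.

Lemma lpa_star_class t : lpa_star (lpa_class t) = lpa_class (term_star t).
Proof. by apply/lpa_classP/term_star_eq/lpa_repr_class. Qed.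

Lemma term_starK t : term_star (term_star t) = t.
Proof.
by elim: t => //= [t -> u ->|k t ->|t -> u ->] //; rewrite barK.
Qed.

Lemma lpa_star_involution : is_involution lpa_mul lpa_star.
Proof.
split.
- elim/lpa_ind=> t; elim/lpa_ind=> u.
  by rewrite -lpa_classD !lpa_star_class /= lpa_classD.
- elim/lpa_ind=> t; elim/lpa_ind=> u.
  by rewrite -lpa_classM !lpa_star_class /= lpa_classM.
- by elim/lpa_ind=> t; rewrite !lpa_star_class term_starK.
Qed.

Lemma lpa_starD x y : lpa_star (x + y) = lpa_star x + lpa_star y.
Proof. by case: lpa_star_involution. Qed.

Lemma lpa_starZ k x : lpa_star (k *: x) = bar k *: lpa_star x.
Proof.
by elim/lpa_ind: x => t; rewrite -lpa_classZ !lpa_star_class /= lpa_classZ.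
Qed.

Fixpoint term_path (t : term) (p : seq (edge E)) : term :=
  if p is e :: p' then term_path (Mul t (Edge e)) p' else t.

Fixpoint term_ghost_path (t : term) (p : seq (edge E)) : term :=
  if p is e :: p' then term_ghost_path (Mul (Ghost e) t) p' else t.

(* [v e1 ... en] and [en^* ... e1^* v] *)
Definition lpa_path (p : vertex E * seq (edge E)) : lpa :=
  lpa_class (term_path (Vert p.1) p.2).
Definition lpa_ghost_path (p : vertex E * seq (edge E)) : lpa :=
  lpa_class (term_ghost_path (Vert p.1) p.2).

Lemma term_star_path t p :
  term_star (term_path t p) = term_ghost_path (term_star t) p.
Proof. by elim: p t => //= e p IHp t; rewrite IHp. Qed.

Lemma lpa_star_path p : lpa_star (lpa_path p) = lpa_ghost_path p.
Proof. by rewrite lpa_star_class term_star_path. Qed.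

Lemma lpa_star_ghost_path p : lpa_star (lpa_ghost_path p) = lpa_path p.
Proof. by rewrite -lpa_star_path; case: lpa_star_involution. Qed.

Lemma lpa_star_span n (k : 'I_n -> K) (p q : 'I_n -> vertex E * seq (edge E)) :
  lpa_star (\sum_i k i *: lpa_mul (lpa_path (p i)) (lpa_ghost_path (q i))) =
  \sum_i bar (k i) *: lpa_mul (lpa_path (q i)) (lpa_ghost_path (p i)).
Proof.
rewrite (big_morph lpa_star lpa_starD (id1 := 0)); last first.
  by rewrite -lpa_class0 lpa_star_class.
apply: eq_bigr => i _; rewrite lpa_starZ.
have [_ -> _] := lpa_star_involution.
by rewrite lpa_star_ghost_path lpa_star_path.
Qed.

End LeavittPathAlgebra.

Arguments lpa_mul {E K}.

(* Main.v *)
(* (i) <-> (ii) is pure ring theory: if a^* a x a^* a = a^* a, then properness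
   gives a = a x a^* a, and a x a^* is a projection generating aR.

   (iii) -> (ii): let F be a finite set of edges and, for a vertex w, let w_F be
   w minus the sum of the e e^* with e in F emitted by w.  The elements
   p w_F q^*, for p and q paths over F ending at w, multiply like matrix units.
   If E is acyclic there are finitely many of them, at most sigma paths p for
   each w, and they span every given element for F large enough; so each
   element lies in a *-homomorphic image of a product of matrix algebras over K,
   each factor of which is either killed or embedded.

   (ii) -> (iii): if p_1, ..., p_n are distinct paths ending at v and E is
   acyclic, then x = sum k_i p_i has x^* x = (sum bar k_i k_i) v.  If E has a
   cycle c at v, then v - c^* has no quasi-inverse: it acts on functions on
   (paths eventually following c) x Z, where c^* shifts the integer; it kills
   the constants and maps the function (y, n) |-> n to a nonzero
   shift-invariant function, but it maps every shift-invariant function to a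
   function vanishing at c c c ... *)

Require Import Defs.
From HB Require Import structures.
From Stdlib Require List.
From mathcomp Require Import all_boot all_order all_algebra.
From mathcomp Require Import boolp classical_sets functions cardinality.

Set Implicit Arguments.
Unset Strict Implicit.
Unset Printing Implicit Defensive.

Import GRing.Theory.
Local Open Scope ring_scope.

(** * Star-regular rings *)

Section StarRegular.
Variables (R : zmodType) (mul : R -> R -> R) (st : R -> R).
Local Notation "x ** y" := (mul x y) (at level 40, left associativity).
Hypothesis mulA : associative mul.
Hypothesis mulDl : left_distributive mul +%R.
Hypothesis mulDr : right_distributive mul +%R.
Hypothesis st_inv : is_involution mul st.

Lemma nonunital_mul0r x : 0 ** x = 0.
Proof. by apply: (addrI (0 ** x)); rewrite -mulDl !addr0. Qed.

Lemma nonunital_mulr0 x : x ** 0 = 0.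
Proof. by apply: (addrI (x ** 0)); rewrite -mulDr !addr0. Qed.

Lemma nonunital_mulNr x y : - x ** y = - (x ** y).
Proof. by apply: (addrI (x ** y)); rewrite -mulDl !subrr nonunital_mul0r. Qed.

Lemma nonunital_mulrN x y : x ** - y = - (x ** y).
Proof. by apply: (addrI (x ** y)); rewrite -mulDr !subrr nonunital_mulr0. Qed.

Lemma involution0 : st 0 = 0.
Proof.
by case: st_inv => stD _ _; apply: (addrI (st 0)); rewrite -stD !addr0.
Qed.

Lemma involutionN x : st (- x) = - st x.
Proof.
case: st_inv => stD _ _; apply: (addrI (st x)).
by rewrite -stD !subrr involution0.
Qed.

Lemma proper_involutionP :
  proper_involution mul st <-> forall x, st x ** x = 0 -> x = 0.
Proof.
split=> [st_proper x x0|st_proper x].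
  by apply: (st_proper (fun=> x) _ ord0); rewrite big_ord1.
by rewrite big_ord1 => /st_proper x0 i; rewrite ord1.
Qed.

Lemma regular_proper_star_regular :
  vn_regular mul -> proper_involution mul st -> star_regular mul st.
Proof.
case: (st_inv) => stD stM stK reg /proper_involutionP st_proper a.
(* The difference [y] of the two sides satisfies [st a ** y = 0], and [st y] has the form
   [z ** st a - st a]. Hence [st y ** y = 0], and properness applies. *)
have cancel x : st a ** a ** x ** (st a ** a) = st a ** a ->
    a ** x ** st a ** a = a.
  move=> ax; apply/eqP; rewrite -subr_eq0; apply/eqP/st_proper.
  set y := _ - a; have ay : st a ** y = 0.
    by rewrite mulDr nonunital_mulrN !mulA -(mulA _ (st a)) ax subrr.
  have -> : st y = st a ** a ** st x ** st a - st a.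
    by rewrite stD involutionN !stM stK !mulA.
  by rewrite mulDl nonunital_mulNr -!mulA ay !nonunital_mulr0 subr0.
have [x xP] := reg (st a ** a).
have pa := cancel x xP.
(* Since [st a ** a] is self-adjoint, [st x] is a quasi-inverse of it as well. *)
have pa' : a ** st x ** st a ** a = a.
  apply: cancel; have aa : st (st a ** a) = st a ** a by rewrite stM stK.
  by rewrite -[RHS]aa -[in RHS]xP !stM !stK !mulA.
(* An element p with [st p ** p = p] is self-adjoint. *)
have pp : st (a ** x ** st a) ** (a ** x ** st a) = a ** x ** st a.
  by rewrite !stM stK !mulA pa'.
exists (a ** x ** st a); split.
  split; last by rewrite !mulA pa.
  by rewrite -{1}pp stM stK pp.
apply/seteqP; split=> _ [r _ <-].
  by exists (a ** r) => //; rewrite mulA pa.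
by exists (x ** st a ** r) => //; rewrite !mulA.
Qed.

Hypothesis right_unit : forall x, exists u, x ** u = x.

(** [right_unit] puts a in aR, so aR = pR yields p = ab and pa = a. Then aba = a; and if [st a ** a]
    vanishes, so does a = pa = [st p ** a] = [st b ** st a ** a]. *)
Lemma star_regular_regular_proper :
  star_regular mul st -> vn_regular mul /\ proper_involution mul st.
Proof.
case: (st_inv) => stD stM stK sreg.
have {}sreg a : exists p b, [/\ st p = p, p = a ** b & p ** a = a].
  have [p [[stp pp] aRpR]] := sreg a.
  have [b _ ab] : principal_right_ideal mul a p by rewrite aRpR; exists p.
  have [c _ pc] : principal_right_ideal mul p a.
    by have [u au] := right_unit a; rewrite -aRpR; exists u.
  by exists p, b; split=> //; rewrite -pc mulA pp.
split=> [a|].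
  by have [p [b [_ pE pa]]] := sreg a; exists b; rewrite -pE.
apply/proper_involutionP => a a0; have [p [b [stp pE pa]]] := sreg a.
by rewrite -pa -stp pE stM -mulA a0 nonunital_mulr0.
Qed.

End StarRegular.

(** * Generators and paths *)

Section LpaGenerators.
Variables (E : graph) (K : fieldType).
Local Notation L := (lpa E K).
Local Notation "x ** y" := (@lpa_mul E K x y) (at level 40, left associativity).

HB.instance Definition _ := gen_eqMixin (vertex E).
HB.instance Definition _ := gen_choiceMixin (vertex E).
HB.instance Definition _ := gen_eqMixin (edge E).
HB.instance Definition _ := gen_choiceMixin (edge E).

Definition lpa_vert (v : vertex E) : L := lpa_class (Vert K v).
Definition lpa_edge (e : edge E) : L := lpa_class (Edge K e).
Definition lpa_ghost (e : edge E) : L := lpa_class (Ghost K e).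

Lemma lpa_mul0r (x : L) : 0 ** x = 0.
Proof. exact: (nonunital_mul0r (@lpa_mulDl E K)). Qed.

Lemma lpa_mulr0 (x : L) : x ** 0 = 0.
Proof. exact: (nonunital_mulr0 (@lpa_mulDr E K)). Qed.

Lemma lpa_mulBl (x y z : L) : (x - y) ** z = x ** z - y ** z.
Proof. by rewrite lpa_mulDl (nonunital_mulNr (@lpa_mulDl E K)). Qed.

Lemma lpa_mulBr (x y z : L) : x ** (y - z) = x ** y - x ** z.
Proof. by rewrite lpa_mulDr (nonunital_mulrN (@lpa_mulDr E K)). Qed.

Lemma lpa_mul_suml I (r : seq I) P (F : I -> L) x :
  (\sum_(i <- r | P i) F i) ** x = \sum_(i <- r | P i) F i ** x.
Proof.
apply: (big_morph (fun y => y ** x)); last exact: lpa_mul0r.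
by move=> y z; rewrite lpa_mulDl.
Qed.

Lemma lpa_mul_sumr I (r : seq I) P (F : I -> L) x :
  x ** (\sum_(i <- r | P i) F i) = \sum_(i <- r | P i) x ** F i.
Proof.
apply: (big_morph (fun y => x ** y)); last exact: lpa_mulr0.
by move=> y z; rewrite lpa_mulDr.
Qed.

Lemma lpa_vertM v w :
  lpa_vert v ** lpa_vert w = if v == w then lpa_vert v else 0.
Proof.
rewrite -lpa_classM; case: eqP => [->|vw]; first exact/lpa_classP/lpa_V_idem.
exact/lpa_classP/lpa_V_orth.
Qed.

Lemma lpa_vert_edge v e :
  lpa_vert v ** lpa_edge e = if v == source e then lpa_edge e else 0.
Proof.
have se : lpa_vert (source e) ** lpa_edge e = lpa_edge e.
  by rewrite -lpa_classM; exact/lpa_classP/lpa_P1_source.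
by rewrite -{1}se lpa_mulA lpa_vertM; case: eqP => [->|_] //; rewrite lpa_mul0r.
Qed.

Lemma lpa_edge_vert v e :
  lpa_edge e ** lpa_vert v = if v == range_of e then lpa_edge e else 0.
Proof.
have re : lpa_edge e ** lpa_vert (range_of e) = lpa_edge e.
  by rewrite -lpa_classM; exact/lpa_classP/lpa_P1_range.
rewrite -{1}re -lpa_mulA lpa_vertM eq_sym.
by case: eqP => // _; rewrite lpa_mulr0.
Qed.

Lemma lpa_ghost_vert v e :
  lpa_ghost e ** lpa_vert v = if v == source e then lpa_ghost e else 0.
Proof.
have re : lpa_ghost e ** lpa_vert (source e) = lpa_ghost e.
  by rewrite -lpa_classM; exact/lpa_classP/lpa_P2_source.
rewrite -{1}re -lpa_mulA lpa_vertM eq_sym.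
by case: eqP => // _; rewrite lpa_mulr0.
Qed.

Lemma lpa_ghost_edge e f :
  lpa_ghost e ** lpa_edge f = if e == f then lpa_vert (range_of e) else 0.
Proof.
rewrite -lpa_classM; case: eqP => [->|ef]; first exact/lpa_classP/lpa_CK1_same.
exact/lpa_classP/lpa_CK1_diff.
Qed.

Lemma lpa_vert_local_unit v (V : seq (vertex E)) : uniq V ->
  lpa_vert v ** (\sum_(w <- V) lpa_vert w) = if v \in V then lpa_vert v else 0.
Proof.
move=> V_uniq; rewrite lpa_mul_sumr (eq_bigr _ (fun w _ => lpa_vertM v w)).
case: ifP => vV.
  rewrite (bigD1_seq v) //= eqxx big1 ?addr0 // => w.
  by rewrite eq_sym => /negPf ->.
rewrite big_seq big1 // => w wV.
by case: eqP => // vw; rewrite vw wV in vV.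
Qed.

Lemma lpa_right_unit (x : L) : exists u, x ** u = x.
Proof.
(* Every larger list of vertices must serve too, so that the lists found for the subterms can be
   merged. *)
have right_unitV (t : term E K) : exists V0 : seq (vertex E),
    forall V, {subset V0 <= V} -> uniq V ->
    lpa_class t ** (\sum_(w <- V) lpa_vert w) = lpa_class t.
  elim: t => [v|e|e||t [V tV] u [W uW]|k t [V tV]|t _ u [W uW]].
  - exists [:: v] => V sV V_uniq.
    by rewrite lpa_vert_local_unit // sV ?mem_head.
  - exists [:: range_of e] => V sV V_uniq; rewrite -/(lpa_edge e).
    rewrite -[lpa_edge e](_ : lpa_edge e ** lpa_vert (range_of e) = _).
      by rewrite -lpa_mulA lpa_vert_local_unit // sV ?mem_head.
    by rewrite lpa_edge_vert eqxx.
  - exists [:: source e] => V sV V_uniq; rewrite -/(lpa_ghost e).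
    rewrite -[lpa_ghost e](_ : lpa_ghost e ** lpa_vert (source e) = _).
      by rewrite -lpa_mulA lpa_vert_local_unit // sV ?mem_head.
    by rewrite lpa_ghost_vert eqxx.
  - by exists [::] => V _ _; rewrite lpa_class0 lpa_mul0r.
  - exists (V ++ W) => U sU U_uniq; rewrite lpa_classD lpa_mulDl.
    by rewrite tV ?uW // => w wV; apply: sU; rewrite mem_cat wV ?orbT.
  - by exists V => U sU U_uniq; rewrite lpa_classZ lpa_scaleAl tV.
  - by exists W => U sU U_uniq; rewrite lpa_classM -lpa_mulA uW.
elim/lpa_ind: x => t; have [V tV] := right_unitV t.
exists (\sum_(w <- undup V) lpa_vert w).
by apply: tV; rewrite ?undup_uniq // => v; rewrite mem_undup.
Qed.

End LpaGenerators.

(** * Duplicate-free lists and finite cardinal bounds *)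

Lemma InP (T : eqType) (x : T) s : List.In x s <-> x \in s.
Proof.
elim: s => //= y s IHs; rewrite inE.
by split=> [[->|/IHs ->]|/orP[/eqP ->|/IHs]]; rewrite ?eqxx ?orbT; auto.
Qed.

Lemma NoDup_uniq (T : eqType) (s : seq T) : List.NoDup s <-> uniq s.
Proof.
elim: s => [|x s IHs] /=; first by split=> // _; exact: List.NoDup_nil.
rewrite List.NoDup_cons_iff InP IHs.
by split=> [[/negP -> ->]|/andP[/negP]].
Qed.

Lemma uniq_map_inj_in (T U : eqType) (f : T -> U) s :
  uniq (map f s) -> {in s &, injective f}.
Proof.
elim: s => //= z s IHs /andP[zs s_uniq] x y; rewrite !inE.
move=> /predU1P[->|xs] /predU1P[->|ys] // fxy; last exact: IHs.
  by rewrite fxy map_f in zs.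
by rewrite -fxy map_f in zs.
Qed.

Section FiniteCardinals.
Local Open Scope classical_set_scope.
Local Open Scope card_scope.

Lemma uniq_size_card_le (T : choiceType) (A : set T) (s : seq T) m :
  uniq s -> (forall x, x \in s -> A x) -> A #<= `I_m -> (size s <= m)%N.
Proof.
case: s => // x s s_uniq sA Am; rewrite -card_le_II; apply: card_le_trans Am.
suff [f] : $|{injfun `I_(size (x :: s)) >-> A}| by exact: inj_card_le f.
apply/injfunPex; exists (nth x (x :: s)) => [i /= si|i j].
  by apply: sA; rewrite mem_nth.
by rewrite !inE => si sj /eqP; rewrite nth_uniq // => /eqP.
Qed.

(** This will supply n distinct paths into one vertex when n - 1 is not a bound for their number. *)
Lemma card_gt_uniq_seq (T : choiceType) (A : set T) m : ~ (A #<= `I_m) ->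
  exists s, [/\ uniq s, size s = m.+1 & forall x, x \in s -> A x].
Proof.
move=> Am; suff [s [s_uniq ms sA]] : exists s,
    [/\ uniq s, (m < size s)%N & forall x, x \in s -> A x].
  exists (take m.+1 s); rewrite take_uniq ?size_takel //.
  by split=> // x /mem_take/sA.
have [/finite_seqP[s As]|/(infinite_set_fset m.+1)[B BA Bm]] :=
  pselect (finite_set A).
  exists (undup s); split; rewrite ?undup_uniq //; last first.
    by move=> x; rewrite mem_undup As.
  rewrite ltnNge; apply/negP => sm; apply: Am.
  suff [f] : $|{injfun A >-> `I_m}| by exact: inj_card_le f.
  apply/injfunPex; exists (index^~ (undup s)) => [x|x y].
    by rewrite As /= => xs; apply: leq_trans sm; rewrite index_mem mem_undup.
  by rewrite As !inE /= => xs ys; apply: index_inj; rewrite // mem_undup.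
by exists (finmap.enum_fset B); split=> //; exact: finmap.fset_uniq.
Qed.

End FiniteCardinals.

(** * Concatenation of paths, and paths in acyclic graphs *)

Section Paths.
Variable E : graph.
Implicit Types (v w : vertex E) (e : edge E) (p q : seq (edge E)).

Lemma is_path_cat v p q :
  is_path v (p ++ q) <-> is_path v p /\ is_path (path_range v p) q.
Proof.
elim: p v => [|e p IHp] v /=; first by split=> // -[].
by rewrite IHp; split=> [[-> []]|[[-> ] //]].
Qed.

Lemma path_range_cat v p q :
  path_range v (p ++ q) = path_range (path_range v p) q.
Proof. by rewrite /path_range map_cat last_cat. Qed.

Lemma acyclic_uniq_source v p :
  acyclic E -> is_path v p -> uniq (map (@source E) p).
Proof.
move=> acE; elim: p v => //= e p IHp v [_ re].
rewrite (IHp _ re) andbT; apply/negP => /mapP[f fp ef].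
(* [f'] is the first edge of [p] leaving the source of [e], so [e :: p1] returns there without
   repeating a source: a cycle. *)
have [p1 [f' [p2 [pE ef' nse]]]] : exists p1 f' p2,
    [/\ p = p1 ++ f' :: p2, source e = source f'
      & source e \notin map (@source E) p1].
  elim: (p) fp => //= a q IHq; rewrite inE.
  have [ea _|ea] := eqVneq (source e) (source a); first by exists [::], a, q.
  case/orP=> [/eqP fa|/IHq [p1 [f' [p2 [-> ef' np]]]]].
    by rewrite ef fa eqxx in ea.
  by exists (a :: p1), f', p2; split; rewrite //= inE negb_or ea.
move: re (IHp _ re).
rewrite pE is_path_cat map_cat cat_uniq /= => -[re1 [sf' _]].
case/and3P => p1_uniq _ _.
apply: (acE (source e) (e :: p1)); split=> //=.
  by rewrite ef' sf'.
by apply/NoDup_uniq; rewrite /= nse p1_uniq.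
Qed.

(** Going around a nonempty closed path twice would repeat a source. *)
Lemma acyclic_closed_path v p :
  acyclic E -> is_path v p -> path_range v p = v -> p = [::].
Proof.
case: p => // e p acE ep epv.
have /(acyclic_uniq_source acE) : is_path v ((e :: p) ++ (e :: p)).
  by rewrite is_path_cat epv.
by rewrite map_cat cat_uniq /= inE eqxx /= andbF.
Qed.

End Paths.

(** * Paths as elements of the algebra *)

Section PathElements.
Variables (E : graph) (K : fieldType).
Local Notation L := (lpa E K).
Local Notation "x ** y" := (@lpa_mul E K x y) (at level 40, left associativity).
Implicit Types (v w : vertex E) (e : edge E) (p q : seq (edge E)).

Lemma lpa_class_term_path_congr (t u : term E K) p :
  lpa_class t = lpa_class u ->
  lpa_class (term_path t p) = lpa_class (term_path u p).
Proof.
by elim: p t u => //= e p IHp t u tu; apply: IHp; rewrite !lpa_classM tu.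
Qed.

Lemma lpa_class_term_pathM (t u : term E K) p :
  lpa_class (term_path (Mul t u) p) = lpa_class t ** lpa_class (term_path u p).
Proof.
elim: p u => [|e p IHp] u /=; first by rewrite lpa_classM.
rewrite -IHp; apply: lpa_class_term_path_congr.
by rewrite !lpa_classM lpa_mulA.
Qed.

Lemma lpa_path_nil v : lpa_path K (v, [::]) = lpa_vert K v.
Proof. by []. Qed.

Lemma lpa_path_cons e p :
  lpa_path K (source e, e :: p) = lpa_edge K e ** lpa_path K (range_of e, p).
Proof.
rewrite /lpa_path /= -lpa_class_term_pathM.
apply: lpa_class_term_path_congr; rewrite !lpa_classM -!/(lpa_edge _ _).
by rewrite -!/(lpa_vert _ _) lpa_vert_edge lpa_edge_vert !eqxx.
Qed.

Lemma lpa_path_rcons v p e :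
  lpa_path K (v, rcons p e) = lpa_path K (v, p) ** lpa_edge K e.
Proof.
rewrite /lpa_path /=.
by elim: p (Vert K v) => [|f p IHp] t /=; rewrite ?lpa_classM.
Qed.

Lemma lpa_vert_path v p :
  is_path v p -> lpa_vert K v ** lpa_path K (v, p) = lpa_path K (v, p).
Proof.
case: p => [_|e p /= [<- _]]; first by rewrite lpa_vertM eqxx.
by rewrite lpa_path_cons lpa_mulA lpa_vert_edge eqxx.
Qed.

Lemma lpa_path_vert v p : is_path v p ->
  lpa_path K (v, p) ** lpa_vert K (path_range v p) = lpa_path K (v, p).
Proof.
elim: p v => [v _|e p IHp v /= [<- ep]]; first by rewrite lpa_vertM eqxx.
by rewrite lpa_path_cons -lpa_mulA IHp.
Qed.

End PathElements.

(** * Matrix units over a finite set of edges *)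

Section MatrixUnits.
Variables (E : graph) (K : fieldType) (bar : K -> K).
Hypothesis bar_inv : is_involution *%R bar.
Local Notation L := (lpa E K).
Local Notation "x ** y" := (@lpa_mul E K x y) (at level 40, left associativity).
Local Notation path := (vertex E * seq (edge E))%type.
Local Notation st := (@lpa_star E K bar).
Local Notation vert := (lpa_vert K).
Local Notation ed := (lpa_edge K).
Local Notation pth := (@lpa_path E K).
Local Notation rg p := (path_range p.1 p.2).
Implicit Types (v w : vertex E) (e : edge E).

Lemma lpa_starM (x y : L) : st (x ** y) = st y ** st x.
Proof. by case: (lpa_star_involution E bar_inv). Qed.

Lemma lpa_starK (x : L) : st (st x) = x.
Proof. by case: (lpa_star_involution E bar_inv). Qed.

Lemma lpa_star0 : st 0 = 0.
Proof. exact: involution0 (lpa_star_involution E bar_inv). Qed.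

Lemma lpa_starN (x : L) : st (- x) = - st x.
Proof. exact: involutionN (lpa_star_involution E bar_inv) x. Qed.

Lemma lpa_star_sum I (r : seq I) P (G : I -> L) :
  st (\sum_(i <- r | P i) G i) = \sum_(i <- r | P i) st (G i).
Proof. exact: (big_morph st (lpa_starD bar_inv) lpa_star0). Qed.

Lemma lpa_star_vert v : st (vert v) = vert v.
Proof. exact: lpa_star_class. Qed.

Lemma lpa_star_edge e : st (ed e) = lpa_ghost K e.
Proof. exact: lpa_star_class. Qed.

Variable F : seq (edge E).
Hypothesis F_uniq : uniq F.

(* Written v_F above. *)
Definition gap v : L :=
  vert v - \sum_(e <- F | source e == v) ed e ** st (ed e).

Lemma star_gap v : st (gap v) = gap v.
Proof.
rewrite /gap lpa_starD // lpa_starN lpa_star_vert lpa_star_sum.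
by congr (_ - _); apply: eq_bigr => e _; rewrite lpa_starM lpa_starK.
Qed.

Lemma gap_vert v w : gap v ** vert w = if v == w then gap v else 0.
Proof.
rewrite lpa_mulBl lpa_vertM lpa_mul_suml.
rewrite (eq_bigr (fun e => if v == w then ed e ** st (ed e) else 0)).
  by case: ifP => // _; rewrite big1 ?subrr.
move=> e /eqP <-; rewrite -lpa_mulA lpa_star_edge lpa_ghost_vert eq_sym.
by case: ifP => // _; rewrite lpa_mulr0.
Qed.

Lemma vert_gap v w : vert w ** gap v = if v == w then gap v else 0.
Proof.
rewrite -[LHS]lpa_starK lpa_starM star_gap lpa_star_vert gap_vert.
by case: ifP; rewrite ?star_gap ?lpa_star0.
Qed.

(** If [e] leaves [v], then by (CK1) only the summand of [e] survives; it gives [ed e] and cancels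
    [vert v ** ed e]. Otherwise all terms vanish. *)
Lemma gap_edge v e : e \in F -> gap v ** ed e = 0.
Proof.
move=> eF; rewrite lpa_mulBl lpa_vert_edge lpa_mul_suml.
case: ifP => [/eqP ->|ve].
  rewrite big_mkcond (bigD1_seq e) //= eqxx -lpa_mulA lpa_star_edge.
  rewrite lpa_ghost_edge eqxx lpa_edge_vert eqxx big1 ?addr0 ?subrr // => f.
  move=> /negPf fe; case: ifP => // _.
  by rewrite -lpa_mulA lpa_star_edge lpa_ghost_edge fe lpa_mulr0.
rewrite big1 ?subrr // => f /eqP fv.
rewrite -lpa_mulA lpa_star_edge lpa_ghost_edge; case: eqP => [fe|].
  by rewrite -fe fv eqxx in ve.
by rewrite lpa_mulr0.
Qed.

Lemma ghost_gap v e : e \in F -> st (ed e) ** gap v = 0.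
Proof.
move=> eF; rewrite -[LHS]lpa_starK lpa_starM star_gap lpa_starK gap_edge //.
exact: lpa_star0.
Qed.

Lemma gap_idem v : gap v ** gap v = gap v.
Proof.
rewrite {2}/gap lpa_mulBr gap_vert eqxx lpa_mul_sumr big_seq_cond.
rewrite big1 ?subr0 //.
by move=> e /andP[eF _]; rewrite lpa_mulA gap_edge // lpa_mul0r.
Qed.

Definition path_over (p : path) := is_path p.1 p.2 /\ {subset p.2 <= F}.

(** (CK1) cancels equal first edges and kills distinct ones. When just one path runs out, a gap
    meets an edge of [F] and the product vanishes. *)
Lemma gap_path_gap (p q : path) : path_over p -> path_over q ->
  gap (rg p) ** (st (pth p) ** pth q) ** gap (rg q) =
  if p == q then gap (rg p) else 0.
Proof.
case: p q => [v p] [w q] [/= vp pF] [/= wq qF].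
elim: p q v w vp wq pF qF => [|e p IHp] [|f q] v w.
- move=> _ _ _ _; rewrite /path_range /= !lpa_path_nil lpa_star_vert.
  rewrite lpa_vertM xpair_eqE eqxx andbT.
  case: eqP => [->|]; rewrite ?lpa_mulr0 ?lpa_mul0r //.
  by rewrite gap_vert eqxx gap_idem.
- move=> _ /= [<- wq] _ qF; rewrite lpa_path_nil lpa_star_vert lpa_path_cons.
  rewrite {1}/path_range /= !lpa_mulA gap_vert eqxx gap_edge ?qF ?mem_head //.
  by rewrite !lpa_mul0r xpair_eqE andbF.
- move=> /= [<- vp] _ pF _; rewrite lpa_path_nil lpa_path_cons lpa_starM.
  rewrite -!lpa_mulA vert_gap /path_range /= eqxx.
  by rewrite ghost_gap ?pF ?mem_head // !lpa_mulr0 xpair_eqE andbF.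
- move=> /= [<- vp] [<- wq] pF qF; rewrite !lpa_path_cons lpa_starM.
  have -> : forall x y z t : L, x ** y ** (z ** t) = x ** (y ** z) ** t.
    by move=> x y z t; rewrite !lpa_mulA.
  rewrite lpa_star_edge lpa_ghost_edge.
  have [ef|ef] := eqVneq e f; last first.
    by rewrite !(lpa_mulr0, lpa_mul0r) xpair_eqE eqseq_cons (negPf ef) !andbF.
  rewrite -ef in wq *; rewrite -(lpa_mulA (st _)) lpa_vert_path //.
  have := IHp q _ _ vp wq; rewrite !xpair_eqE eqseq_cons !eqxx /=; apply.
    by move=> g gp; apply: pF; rewrite inE gp orbT.
  by move=> g gq; apply: qF; rewrite inE gq orbT.
Qed.

Definition matrix_unit (p q : path) : L := pth p ** gap (rg p) ** st (pth q).

Lemma star_matrix_unit p q : rg p = rg q ->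
  st (matrix_unit p q) = matrix_unit q p.
Proof.
by move=> pq; rewrite /matrix_unit !lpa_starM lpa_starK star_gap pq !lpa_mulA.
Qed.

Lemma matrix_unitM p q p' q' : path_over q -> path_over p' ->
  rg p = rg q ->
  matrix_unit p q ** matrix_unit p' q' =
  if q == p' then matrix_unit p q' else 0.
Proof.
move=> qF pF' pq; rewrite /matrix_unit.
have -> : pth p ** gap (rg p) ** st (pth q) **
    (pth p' ** gap (rg p') ** st (pth q')) =
    pth p ** (gap (rg q) ** (st (pth q) ** pth p') ** gap (rg p')) **
    st (pth q').
  by rewrite pq !lpa_mulA.
rewrite gap_path_gap //; case: eqP => // _; last by rewrite lpa_mulr0 lpa_mul0r.
by rewrite pq.
Qed.

(** The gap is recovered by multiplying the matrix unit by [gap (rg p) ** st (pth p)] on the left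
    and [pth q ** gap (rg p)] on the right. *)
Lemma matrix_unit_eq0 p q : path_over p -> path_over q -> rg p = rg q ->
  matrix_unit p q = 0 -> gap (rg p) = 0.
Proof.
move=> pF qF pq u0.
have := gap_path_gap qF qF; rewrite eqxx -pq => <-.
have := gap_path_gap pF pF; rewrite eqxx => {1}<-.
suff -> : gap (rg p) ** (st (pth p) ** pth p) ** gap (rg p) **
    (st (pth q) ** pth q) ** gap (rg p) =
  gap (rg p) ** st (pth p) ** matrix_unit p q ** (pth q ** gap (rg p)).
  by rewrite u0 lpa_mulr0 lpa_mul0r.
by rewrite /matrix_unit !lpa_mulA.
Qed.

(** Between [pth p] and [st (pth q)] the range vertex is inserted and split into its gap and the
    edges of [F] that it emits. *)
Lemma path_star_path (p q : path) : path_over p -> rg p = rg q ->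
  pth p ** st (pth q) = matrix_unit p q + \sum_(e <- F | source e == rg p)
    pth (p.1, rcons p.2 e) ** st (pth (q.1, rcons q.2 e)).
Proof.
case: p q => [v p] [w q] [/= vp _] pq.
rewrite -{1}(lpa_path_vert _ vp) /matrix_unit /=.
rewrite -[vert _](subrK (\sum_(e <- F | source e == path_range v p)
  ed e ** st (ed e))) -/(gap _) lpa_mulDr lpa_mulDl; congr (_ + _).
rewrite lpa_mul_sumr lpa_mul_suml; apply: eq_bigr => e _.
by rewrite !lpa_path_rcons lpa_starM !lpa_mulA.
Qed.

(** * The matrix algebra of the paths ending at one vertex *)

Variable P : seq path.
Hypothesis P_uniq : uniq P.
Hypothesis P_over : forall p, p \in P -> path_over p.

Definition paths_over_to w := [seq p <- P | rg p == w].

Definition block_dim w := size (paths_over_to w).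

Definition block_path w (i : 'I_(block_dim w)) : path :=
  tnth (in_tuple (paths_over_to w)) i.
Local Notation bp := block_path.

Lemma block_path_mem w (i : 'I_(block_dim w)) : bp i \in P /\ rg (bp i) = w.
Proof.
have : bp i \in paths_over_to w by apply: mem_tnth.
by rewrite mem_filter => /andP[/eqP ->].
Qed.

Lemma block_path_eq w (i j : 'I_(block_dim w)) : (bp i == bp j) = (i == j).
Proof.
apply/eqP/eqP => [|-> //].
by apply: (tuple_uniqP _ _); rewrite filter_uniq.
Qed.

Definition block w (A : 'M[K]_(block_dim w)) : L :=
  \sum_i \sum_j A i j *: matrix_unit (bp i) (bp j).

Lemma blockD w (A B : 'M_(block_dim w)) : block (A + B) = block A + block B.
Proof.
rewrite /block -big_split; apply: eq_bigr => i _; rewrite -big_split.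
by apply: eq_bigr => j _; rewrite mxE scalerDl.
Qed.

Lemma blockZ w k (A : 'M_(block_dim w)) : block (k *: A) = k *: block A.
Proof.
rewrite /block scaler_sumr; apply: eq_bigr => i _; rewrite scaler_sumr.
by apply: eq_bigr => j _; rewrite mxE scalerA.
Qed.

Lemma block_star w (A : 'M_(block_dim w)) :
  st (block A) = block (map_mx bar A)^T.
Proof.
rewrite /block lpa_star_sum exchange_big /=; apply: eq_bigr => i _.
rewrite lpa_star_sum; apply: eq_bigr => j _.
rewrite lpa_starZ // star_matrix_unit ?mxE //.
by rewrite (block_path_mem i).2 (block_path_mem j).2.
Qed.

Lemma matrix_unit_block w (A : 'M_(block_dim w)) p i : rg p = w ->
  matrix_unit p (bp i) ** block A = \sum_j A i j *: matrix_unit p (bp j).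
Proof.
move=> pw.
rewrite lpa_mul_sumr (bigD1 i) //= [X in _ + X]big1 ?addr0 => [|k ki].
  rewrite lpa_mul_sumr; apply: eq_bigr => j _.
  rewrite lpa_scaleAr matrix_unitM ?eqxx //; try apply: P_over.
  - by have [] := block_path_mem i.
  - by have [] := block_path_mem i.
  - by have [_ ->] := block_path_mem i.
rewrite lpa_mul_sumr big1 // => j _.
rewrite lpa_scaleAr matrix_unitM; try apply: P_over.
- by rewrite block_path_eq eq_sym (negPf ki) scaler0.
- by have [] := block_path_mem i.
- by have [] := block_path_mem k.
- by have [_ ->] := block_path_mem i.
Qed.

Lemma blockM w (A B : 'M_(block_dim w)) : block A ** block B = block (A *m B).
Proof.
rewrite lpa_mul_suml; apply: eq_bigr => i _.
rewrite lpa_mul_suml (eq_bigr (fun j => \sum_k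
    (A i j * B j k) *: matrix_unit (bp i) (bp k))) => [|j _].
  rewrite exchange_big; apply: eq_bigr => k _.
  by rewrite mxE scaler_suml.
rewrite lpa_scaleAl matrix_unit_block ?(block_path_mem i).2 // scaler_sumr.
by apply: eq_bigr => k _; rewrite scalerA.
Qed.

Lemma blockM_neq v w (A : 'M_(block_dim v)) (B : 'M_(block_dim w)) :
  v != w -> block A ** block B = 0.
Proof.
move=> vw; rewrite lpa_mul_suml big1 // => i _.
rewrite lpa_mul_suml big1 // => j _; rewrite lpa_mul_sumr big1 // => k _.
rewrite lpa_mul_sumr big1 // => l _.
have [iP iv] := block_path_mem i; have [jP jv] := block_path_mem j.
have [kP kw] := block_path_mem k; rewrite lpa_scaleAr lpa_scaleAl.
rewrite matrix_unitM ?iv ?jv //; try exact: P_over.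
case: eqP => [jk|]; last by rewrite !scaler0.
by case/negP: vw; apply/eqP; rewrite -[LHS]jv jk kw.
Qed.

(** The map [block] at [w] is injective or zero. If [block A = 0] and [A k l] is nonzero, the
    diagonal matrix units at [k] and [l] isolate that entry, so a matrix unit vanishes; then so does
    the gap at [w], and with it every block at [w]. *)
Lemma block_eq0 w (A B : 'M_(block_dim w)) :
  block A = 0 -> A = 0 \/ block B = 0.
Proof.
move=> A0; have [->|A_neq0] := eqVneq A 0; [by left|right].
apply: big1 => i _; apply: big1 => j _.
suff gap0 : gap w = 0.
  rewrite /matrix_unit (block_path_mem i).2 gap0 lpa_mulr0 lpa_mul0r.
  by rewrite scaler0.
have [k [l Akl]] : exists k l, A k l != 0.
  apply: contrapT => A_eq0; move/eqP: A_neq0; apply; apply/matrixP => k l.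
  by rewrite mxE; apply: contrapT => /eqP Akl; apply: A_eq0; exists k, l.
have [kP kw] := block_path_mem k; have [lP lw] := block_path_mem l.
rewrite -kw; apply: (@matrix_unit_eq0 (bp k) (bp l)); rewrite ?lw //;
  try exact: P_over.
apply: (scalerI Akl); rewrite scaler0.
have : matrix_unit (bp k) (bp k) ** block A ** matrix_unit (bp l) (bp l) = 0.
  by rewrite A0 lpa_mulr0 lpa_mul0r.
rewrite matrix_unit_block // lpa_mul_suml (bigD1 l) //= big1 ?addr0 => [|m ml].
  rewrite lpa_scaleAl matrix_unitM ?eqxx ?kw ?lw //; exact: P_over.
have [mP mw] := block_path_mem m.
rewrite lpa_scaleAl matrix_unitM ?kw ?mw //; try exact: P_over.
by rewrite block_path_eq (negPf ml) scaler0.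
Qed.

(** * Products of matrix algebras over finitely many vertices *)

Variable W : seq (vertex E).
Hypothesis W_uniq : uniq W.

Definition blocks (A : forall w, 'M[K]_(block_dim w)) : L :=
  \sum_(w <- W) block (A w).

Lemma blocksD A B : blocks A + blocks B = blocks (fun w => A w + B w).
Proof.
by rewrite /blocks -big_split; apply: eq_bigr => w _; rewrite blockD.
Qed.

Lemma blocksZ k A : k *: blocks A = blocks (fun w => k *: A w).
Proof.
by rewrite /blocks scaler_sumr; apply: eq_bigr => w _; rewrite blockZ.
Qed.

Lemma blocksM A B : blocks A ** blocks B = blocks (fun w => A w *m B w).
Proof.
rewrite /blocks lpa_mul_suml big_seq [RHS]big_seq; apply: eq_bigr => w wW.
rewrite lpa_mul_sumr (bigD1_seq w) //= big1 ?addr0 => [|v vw].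
  exact: blockM.
by rewrite blockM_neq // eq_sym.
Qed.

Lemma blocks_star A : st (blocks A) = blocks (fun w => (map_mx bar (A w))^T).
Proof.
by rewrite /blocks lpa_star_sum; apply: eq_bigr => w _; rewrite block_star.
Qed.

(** Multiplication by the identity block at [w] isolates one summand. *)
Lemma blocks_eq0 A w : w \in W -> blocks A = 0 -> block (A w) = 0.
Proof.
move=> wW A0; have : @block w 1%:M ** blocks A = 0 by rewrite A0 lpa_mulr0.
rewrite lpa_mul_sumr (bigD1_seq w) //= big1 ?addr0 ?blockM ?mul1mx // => v vw.
by rewrite blockM_neq // eq_sym.
Qed.

Lemma blocks_regular A : exists x, blocks A ** x ** blocks A = blocks A.
Proof.
exists (blocks (fun w => pinvmx (A w))); rewrite !blocksM.
by apply: eq_bigr => w _; rewrite mulmxKpV.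
Qed.

Lemma blocks_proper A :
  (forall w, (0 < block_dim w)%N -> n_proper *%R bar (block_dim w)) ->
  st (blocks A) ** blocks A = 0 -> blocks A = 0.
Proof.
move=> dim_proper; rewrite blocks_star blocksM => AA0.
rewrite /blocks big_seq big1 // => w wW.
have [{}AA0|-> //] := block_eq0 (A w) (blocks_eq0 wW AA0).
rewrite /block big1 // => i _; rewrite big1 // => j _.
suff -> : A w i j = 0 by rewrite scale0r.
have dim_gt0 : (0 < block_dim w)%N by apply: leq_ltn_trans (ltn_ord i).
(* Properness over [K] is applied to column [j]: its sum is the diagonal entry [j] of the conjugate
   transpose of [A w] times [A w]. *)
apply: ((dim_proper w dim_gt0 (fun k => A w k j)) : _ -> forall k, _ = 0).
move/matrixP/(_ j j): AA0; rewrite !mxE => AA; rewrite -[RHS]AA.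
by apply: eq_bigr => k _; rewrite !mxE.
Qed.

Lemma matrix_unit_blocks p q :
  p \in P -> q \in P -> rg p = rg q -> rg p \in W ->
  exists A, matrix_unit p q = blocks A.
Proof.
move=> pP qP pq pW.
(* One formula serves all vertices: at a vertex other than [rg p] no block path equals [p], so the
   matrix is zero. *)
exists (fun w => \matrix_(i, j) ((bp i == p) && (bp j == q))%:R).
have bpP r : r \in P -> rg r = rg p ->
    exists i : 'I_(block_dim (rg p)), bp i = r.
  move=> rP rp; have /tnthP[i ->] : r \in in_tuple (paths_over_to (rg p)).
    by rewrite mem_filter rp eqxx.
  by exists i.
have [i ip] := bpP p pP erefl; have [j jq] := bpP q qP (esym pq).
rewrite /blocks (bigD1_seq (rg p)) //= big1 ?addr0 => [|w wp].
  rewrite /block (bigD1 i) //= (bigD1 j) //= !mxE ip jq !eqxx scale1r.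
  rewrite !big1 ?addr0 // => [k ki|k kj].
    rewrite big1 // => l _.
    by rewrite mxE -[X in _ == X]ip block_path_eq (negPf ki) scale0r.
  by rewrite mxE -[in _ == q]jq block_path_eq (negPf kj) andbF scale0r.
rewrite /block big1 // => k _; rewrite big1 // => l _; rewrite mxE.
case: eqP => [kp|]; last by rewrite scale0r.
by move: wp; rewrite -kp (block_path_mem k).2 eqxx.
Qed.

(** * Elements captured by the blocks of an acyclic graph *)

Hypothesis acE : acyclic E.
Hypothesis PE : forall p : path, p.1 \in W -> path_over p -> p \in P.
Hypothesis sourceW : forall e, e \in F -> source e \in W.
Hypothesis rangeW : forall e, e \in F -> range_of e \in W.

Definition in_blocks (x : L) := exists A, x = blocks A.

Lemma in_blocks0 : in_blocks 0.
Proof.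
exists (fun=> 0); rewrite -[LHS](scale0r (blocks (fun=> 0))) blocksZ.
by congr blocks; apply: functional_extensionality_dep => w; rewrite scaler0.
Qed.

Lemma in_blocksD x y : in_blocks x -> in_blocks y -> in_blocks (x + y).
Proof. by move=> [A ->] [B ->]; rewrite blocksD; eexists. Qed.

(** [path_star_path] leaves a matrix unit and terms with longer paths. This terminates because a
    path over [F] in an acyclic graph repeats no edge, so its length is at most [size F]. *)
Lemma in_blocks_path_star_path (p q : path) : p.1 \in W -> q.1 \in W ->
  path_over p -> path_over q -> rg p = rg q ->
  in_blocks (pth p ** st (pth q)).
Proof.
have size_path r : path_over r -> (size r.2 <= size F)%N.
  move=> [r_path rF]; apply: uniq_leq_size => //.
  exact: map_uniq (acyclic_uniq_source acE r_path).
have [k] := ubnP (size F - size p.2).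
elim: k p q => // k IHk p q pk pW qW pF qF pq.
have pgW : rg p \in W.
  case: (pF) => _; rewrite /path_range; case/lastP: p.2 => //= r e rF.
  by rewrite map_rcons last_rcons rangeW // rF // mem_rcons mem_head.
rewrite path_star_path //; apply: in_blocksD.
  by apply: matrix_unit_blocks => //; apply: PE.
rewrite big_seq_cond; apply: big_ind; [exact: in_blocks0|exact: in_blocksD|].
move=> e /andP[eF /eqP ep].
have rcons_over r : path_over r -> rg r = rg p -> path_over (r.1, rcons r.2 e).
  move=> [r_path rF] rp; split=> [|f]; last first.
    by rewrite mem_rcons inE => /predU1P[->|/rF].
  by rewrite -cats1 is_path_cat /= -/(rg r) rp.
have pF' := rcons_over p pF erefl.
apply: IHk => //=; [|exact: rcons_over|].
  (* The longer path still fits the bound, so the truncated subtraction strictly decreases. *)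
  have := size_path _ pF'; rewrite /= size_rcons => p_size.
  by rewrite subnS prednK ?subn_gt0.
by rewrite -!cats1 !path_range_cat.
Qed.

Lemma in_blocks_vert v : v \in W -> in_blocks (vert v).
Proof.
move=> vW; have -> : vert v = pth (v, [::]) ** st (pth (v, [::])).
  by rewrite lpa_path_nil lpa_star_vert lpa_vertM eqxx.
exact: in_blocks_path_star_path.
Qed.

Lemma in_blocks_edge e : e \in F -> in_blocks (ed e).
Proof.
move=> eF.
have -> : ed e = pth (source e, [:: e]) ** st (pth (range_of e, [::])).
  rewrite lpa_path_cons !lpa_path_nil lpa_star_vert -lpa_mulA lpa_vertM eqxx.
  by rewrite lpa_edge_vert eqxx.
apply: in_blocks_path_star_path => //=; first exact: sourceW.
- exact: rangeW.
- by split=> // f; rewrite inE => /eqP ->.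
Qed.

Lemma in_blocks_star x : in_blocks x -> in_blocks (st x).
Proof. by move=> [A ->]; rewrite blocks_star; eexists. Qed.

Lemma in_blocksM x y : in_blocks x -> in_blocks y -> in_blocks (x ** y).
Proof. by move=> [A ->] [B ->]; rewrite blocksM; eexists. Qed.

Lemma in_blocksZ k x : in_blocks x -> in_blocks (k *: x).
Proof. by move=> [A ->]; rewrite blocksZ; eexists. Qed.

End MatrixUnits.

(** * Vertices and edges of a term, and words of bounded length *)

Section FiniteSupport.
Variables (E : graph) (K : fieldType).

Fixpoint term_verts (t : term E K) : seq (vertex E) :=
  match t with
  | Vert v => [:: v]
  | Add t u | Mul t u => term_verts t ++ term_verts u
  | Scale _ t => term_verts t
  | _ => [::]
  end.

Fixpoint term_edges (t : term E K) : seq (edge E) :=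
  match t with
  | Edge e | Ghost e => [:: e]
  | Add t u | Mul t u => term_edges t ++ term_edges u
  | Scale _ t => term_edges t
  | _ => [::]
  end.

Fixpoint words (F : seq (edge E)) n : seq (seq (edge E)) :=
  if n is n'.+1 then [::] :: [seq e :: p | e <- F, p <- words F n']
  else [:: [::]].

Lemma mem_words F n p : {subset p <= F} -> (size p <= n)%N -> p \in words F n.
Proof.
elim: n p => [|n IHn] [|e p] //= pF pn; rewrite ?mem_head // inE.
apply/orP; right.
apply: allpairs_f; first by rewrite pF ?mem_head.
by apply: IHn => // f fp; rewrite pF // inE fp orbT.
Qed.

Lemma words_subset F n p : p \in words F n -> {subset p <= F}.
Proof.
elim: n p => [|n IHn] p /=; first by rewrite inE => /eqP ->.
rewrite inE => /predU1P[-> //|/allpairsP[[e q] /= [eF /IHn qF ->]]] f.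
by rewrite inE => /predU1P[->|/qF].
Qed.

End FiniteSupport.

(** * From acyclicity and properness over the field to the algebra *)

Section AcyclicStarRegular.
Variables (E : graph) (K : fieldType) (bar : K -> K).
Hypothesis bar_inv : is_involution *%R bar.
Local Notation "x ** y" := (@lpa_mul E K x y) (at level 40, left associativity).
Local Notation path := (vertex E * seq (edge E))%type.
Local Notation st := (@lpa_star E K bar).
Hypothesis acE : acyclic E.

Lemma acyclic_lpa_in_blocks (x : lpa E K) : exists F P W,
  [/\ uniq F, uniq P, uniq W, forall p : path, p \in P -> path_over F p
    & in_blocks bar F P W x].
Proof.
elim/lpa_ind: x => t.
(* [F] and [W] collect the edges and vertices of [t], with the endpoints of [F] added to [W]; [P]
   lists all paths over [F] starting in [W]. The length bound [size F] loses none of them, by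
   acyclicity. *)
pose F := undup (term_edges t).
pose W := undup (term_verts t ++ map (@source E) F ++ map (@range_of E) F).
pose P := undup [seq p <- [seq (w, p) | w <- W, p <- words F (size F)] |
  `[< is_path p.1 p.2 >]].
have P_over p : p \in P -> path_over F p.
  rewrite mem_undup mem_filter => /andP[/asboolP p_path].
  move=> /allpairsP[[w q] /= [_ /words_subset qF pE]]; move: p_path; rewrite pE.
  by split.
have PE p : p.1 \in W -> path_over F p -> p \in P.
  move=> pW [p_path pF]; rewrite mem_undup mem_filter; apply/andP; split.
    exact/asboolP.
  apply/allpairsP; exists p; split=> //; last by case: (p).
  apply: mem_words => //; apply: uniq_leq_size => //.
  exact: map_uniq (acyclic_uniq_source acE p_path).
have sourceW e : e \in F -> source e \in W.
  by move=> eF; rewrite mem_undup !mem_cat map_f ?orbT.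
have rangeW e : e \in F -> range_of e \in W.
  by move=> eF; rewrite mem_undup !mem_cat (map_f _ eF) !orbT.
exists F, P, W; split=> //; rewrite ?undup_uniq //.
have tW v : v \in term_verts t -> v \in W by rewrite mem_undup mem_cat => ->.
have tF e : e \in term_edges t -> e \in F by rewrite mem_undup.
have F_uniq : uniq F by rewrite undup_uniq.
have P_uniq : uniq P by rewrite undup_uniq.
have W_uniq : uniq W by rewrite undup_uniq.
(* [F], [W] and [P] are frozen before the induction, so that all subterms live in the same
   blocks. *)
move: tW tF; clearbody F W P.
elim: t => [v|e|e||t IHt u IHu|k t IHt|t IHt u IHu] /= tW tF.
- by apply: in_blocks_vert => //; apply: tW; rewrite mem_head.
- by apply: in_blocks_edge => //; apply: tF; rewrite mem_head.
- rewrite -/(lpa_ghost K e) -(lpa_star_edge bar_inv).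
  apply: in_blocks_star => //.
  by apply: in_blocks_edge => //; apply: tF; rewrite mem_head.
- exact: in_blocks0.
- rewrite lpa_classD; apply: in_blocksD; [apply: IHt|apply: IHu] => v vt;
    by [apply: tW; rewrite mem_cat vt ?orbT
       |apply: tF; rewrite mem_cat vt ?orbT].
- by rewrite lpa_classZ; apply: in_blocksZ; apply: IHt.
- rewrite lpa_classM; apply: in_blocksM => //; [apply: IHt|apply: IHu] => v vt;
    by [apply: tW; rewrite mem_cat vt ?orbT
       |apply: tF; rewrite mem_cat vt ?orbT].
Qed.

(** This bounds the block dimensions, since the paths indexing a block share their range. *)
Lemma le_sigma_size (w : vertex E) (s : seq path) : uniq s ->
  (forall p, p \in s -> is_path p.1 p.2 /\ path_range p.1 p.2 = w) ->
  le_sigma E (size s).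
Proof.
move=> s_uniq sw; rewrite /le_sigma /sigma; case: pselect => // bounded.
case: ex_minnP => m /asboolP/(_ w) mw _.
apply: uniq_size_card_le s_uniq _ mw => p /sw.
by [].
Qed.

Lemma acyclic_regular : vn_regular (@lpa_mul E K).
Proof.
move=> x; have [F [P [W [FU PU WU PF [A ->]]]]] := acyclic_lpa_in_blocks x.
exact: blocks_regular.
Qed.

Lemma acyclic_proper :
  (forall n, (0 < n)%N -> le_sigma E n -> n_proper *%R bar n) ->
  proper_involution (@lpa_mul E K) st.
Proof.
move=> K_proper; apply/proper_involutionP => x.
have [F [P [W [FU PU WU PF [A ->]]]]] := acyclic_lpa_in_blocks x.
apply: blocks_proper => // w dim_gt0; apply: K_proper => //.
apply: (@le_sigma_size w); first exact: filter_uniq.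
by move=> p; rewrite mem_filter => /andP[/eqP pw /PF[]].
Qed.

End AcyclicStarRegular.

(** * A module of functions on maximal paths *)

Section PathModule.
Variables (E : graph) (K : fieldType).
Variables (next : vertex E -> option (edge E)) (weight : edge E -> int).
Hypothesis next_source : forall v e, next v = Some e -> source e = v.
Hypothesis next_None :
  forall v, next v = None -> is_sink v \/ infinite_emitter v.
Local Notation L := (lpa E K).
Local Notation "x ** y" := (@lpa_mul E K x y) (at level 40, left associativity).

(* A state [(v, p, n)] stands for the maximal path that starts with [p] at [v]
   and then follows [next] forever, or until it reaches a vertex where [next]
   is [None]; it has a unique [normal] encoding, in which [p] does not end with
   an edge prescribed by [next].  The integer [n] records weights. *)
Definition state : Type := vertex E * seq (edge E) * int.

Fixpoint normal v (p : seq (edge E)) : bool :=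
  if p is e :: p' then
    [&& source e == v, normal (range_of e) p'
      & (p' != [::]) || (next v != Some e)]
  else true.

Definition starts_at v (y : state) : bool := normal y.1.1 y.1.2 && (y.1.1 == v).

Definition first_edge (y : state) : option (edge E) :=
  if y.1.2 is e :: _ then Some e else next y.1.1.

Definition starts_with e (y : state) : bool :=
  normal y.1.1 y.1.2 && (first_edge y == Some e).

Definition drop_edge e (y : state) : state :=
  (range_of e, behead y.1.2, y.2 - weight e).

(** A prescribed edge put before an empty sequence is absorbed, which keeps the encoding normal. *)
Definition add_edge e (y : state) : state :=
  (source e, if (y.1.2 == [::]) && (next (source e) == Some e) then [::]
             else e :: y.1.2, y.2 + weight e).

(** With [starts_atP], this makes dropping and adding [e] inverse bijections between the normal
    states starting with [e] and those at the range of [e]. *)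
Lemma starts_withP e y : starts_with e y ->
  [/\ starts_at (source e) y, starts_at (range_of e) (drop_edge e y)
    & add_edge e (drop_edge e y) = y].
Proof.
case: y => [[v [|f p]] n]; rewrite /starts_with /starts_at /= /first_edge /=.
  move=> /eqP ve; have ev := next_source ve; split=> //; rewrite ?ev ?eqxx //.
  by rewrite /add_edge /= ev ve eqxx subrK.
move=> /andP[/and3P[/eqP <- p_normal ep] /eqP[fe]]; rewrite fe in p_normal ep *.
split; rewrite ?eqxx ?p_normal //=; first by rewrite ep.
by rewrite /add_edge /= subrK; move: ep; case: eqP => //= _ /negPf ->.
Qed.

Lemma starts_atP e y : starts_at (range_of e) y ->
  starts_with e (add_edge e y) /\ drop_edge e (add_edge e y) = y.
Proof.
case: y => [[v p] n]; rewrite /starts_at /= => /andP[p_normal /eqP ve].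
rewrite {}ve in p_normal *.
rewrite /starts_with /add_edge /drop_edge /= addrK.
case: eqP => [->|/eqP pN0] /=; last first.
  by rewrite eqxx p_normal pN0 /first_edge /= eqxx.
rewrite /first_edge; case: eqP => [ee|/eqP ee] /=; first by rewrite ee eqxx.
by rewrite !eqxx ee.
Qed.

Fixpoint eval (t : term E K) (f : state -> K) : state -> K :=
  match t with
  | Vert v => fun y => if starts_at v y then f y else 0
  | Edge e => fun y => if starts_with e y then f (drop_edge e y) else 0
  | Ghost e => fun y => if starts_at (range_of e) y then f (add_edge e y) else 0
  | Zero => fun=> 0
  | Add t u => fun y => eval t f y + eval u f y
  | Scale k t => fun y => k * eval t f y
  | Mul t u => eval t (eval u f)
  end.

Lemma evalD t f g :
  eval t (fun y => f y + g y) = fun y => eval t f y + eval t g y.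
Proof.
elim: t f g => [v|e|e||t IHt u IHu|k t IHt|t IHt u IHu] f g /=;
  rewrite ?IHu ?IHt //; apply: funext => y /=; try by case: ifP; rewrite ?addr0.
- by rewrite addr0.
- by rewrite addrACA.
- by rewrite mulrDr.
Qed.

Lemma evalZ t k f : eval t (fun y => k * f y) = fun y => k * eval t f y.
Proof.
elim: t f => [v|e|e||t IHt u IHu|l t IHt|t IHt u IHu] f /=;
  rewrite ?IHu ?IHt //; apply: funext => y /=; try by case: ifP; rewrite ?mulr0.
- by rewrite mulr0.
- by rewrite mulrDr.
- by rewrite mulrCA.
Qed.

Definition shift (y : state) : state := (y.1, y.2 + 1).

(** The action translates the integer but never tests it. Hence it preserves shift-invariant
    functions. *)
Lemma eval_shift t f : eval t (f \o shift) = eval t f \o shift.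
Proof.
elim: t f => [v|e|e||t IHt u IHu|l t IHt|t IHt u IHu] f /=;
  rewrite ?IHu ?IHt //; apply: funext => y //=.
  by rewrite /drop_edge /shift /= addrAC.
by rewrite /add_edge /shift /= addrAC.
Qed.

Lemma eval_term_sum s f y : eval (term_sum s) f y = \sum_(t <- s) eval t f y.
Proof. by elim: s => [|t s IHs] /=; rewrite ?big_nil ?big_cons ?IHs. Qed.

Lemma eval_lpa_eq t u : lpa_eq t u -> eval t = eval u.
Proof.
elim=> {t u} /=.
- by [].
- by [].
- by move=> t u w _ -> _ ->.
- by move=> t t' u u' _ -> _ ->.
- by move=> k t t' _ ->.
- by move=> t t' u u' _ -> _ ->.
- by move=> t u w; apply: funext => f; apply: funext => y; rewrite addrA.
- by move=> t u; apply: funext => f; apply: funext => y; rewrite addrC.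
- by move=> t; apply: funext => f; apply: funext => y; rewrite add0r.
- by move=> t; apply: funext => f; apply: funext => y; rewrite mul0r.
- by move=> t; apply: funext => f; apply: funext => y; rewrite mul1r.
- by move=> k l t; apply: funext => f; apply: funext => y; rewrite mulrA.
- by move=> k t u; apply: funext => f; apply: funext => y; rewrite mulrDr.
- by move=> k l t; apply: funext => f; apply: funext => y; rewrite mulrDl.
- by [].
- by [].
- by move=> t u w; apply: funext => f; rewrite evalD.
- by [].
- by move=> t k u; apply: funext => f; rewrite evalZ.
- by move=> v; apply: funext => f; apply: funext => y; case: (starts_at v y).
- move=> v w vw; apply: funext => f; apply: funext => y.
  case: ifP => // /andP[_ /eqP yv]; case: ifP => // /andP[_ /eqP yw].
  by case: vw; rewrite -yv.
- move=> e; apply: funext => f; apply: funext => y.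
  case: (boolP (starts_with e y)) => [/starts_withP[-> _ _] //|_].
  by rewrite if_same.
- move=> e; apply: funext => f; apply: funext => y.
  by case: ifP => // /starts_withP[_ -> _].
- by move=> e; apply: funext => f; apply: funext => y; case: (starts_at _ y).
- move=> e; apply: funext => f; apply: funext => y.
  by case: ifP => // /starts_atP[/starts_withP[-> _ _] _].
- move=> e; apply: funext => f; apply: funext => y.
  by case: ifP => // /starts_atP[-> ->].
- move=> e f ef; apply: funext => h; apply: funext => y.
  case: ifP => // /starts_atP[/andP[_ /eqP ye] _]; case: ifP => // /andP[_].
  by rewrite ye => /eqP[].
(* For (CK2), a normal state at [v] has a first edge, because [next_None] excludes [None] at [v];
   exactly the summand of that edge survives. *)
move=> v es v_emits v_finite /NoDup_uniq es_uniq esP.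
apply: funext => f; apply: funext => y; rewrite eval_term_sum big_map /=.
rewrite (eq_bigr (fun e => if starts_with e y then f y else 0)) => [|e _];
  last first.
  by case: ifP => // /starts_withP[_ -> ->].
case: ifP => [/andP[y_normal /eqP yv]|yv]; last first.
  rewrite big_seq big1 // => e /InP/esP ev.
  case: ifP => // /starts_withP[ye _ _].
  by rewrite -ev ye in yv.
have [e ye] : exists e, first_edge y = Some e.
  case ye: (first_edge y) => [e|]; first by exists e.
  move: ye; rewrite /first_edge; case: (y.1.2) => //.
  by rewrite yv => /next_None[].
have ey : starts_with e y by rewrite /starts_with y_normal ye /=.
have e_es : e \in es.
  apply/InP/esP; have [/andP[_ /eqP ev] _ _] := starts_withP ey.
  by rewrite /out_edges /= -ev.
rewrite (bigD1_seq e) //= ey big1 ?addr0 // => e' e'e.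
case: ifP => // /andP[_]; rewrite ye => /eqP[ee'].
by rewrite ee' eqxx in e'e.
Qed.

Definition act (x : L) : (state -> K) -> state -> K := eval (lpa_repr x).

Lemma act_class t : act (lpa_class t) = eval t.
Proof. exact/eval_lpa_eq/lpa_repr_class. Qed.

Lemma actM x z f : act (x ** z) f = act x (act z f).
Proof.
rewrite -[in LHS](lpa_reprK x) -[in LHS](lpa_reprK z).
by rewrite -lpa_classM act_class.
Qed.

Lemma act0 f y : act 0 f y = 0.
Proof. by rewrite -lpa_class0 act_class. Qed.

Lemma act_vert_neq0 (v : vertex E) : lpa_vert K v <> 0.
Proof.
move=> v0; have /eqP := act0 (fun=> 1) ((v, [::], 0) : state).
by rewrite -v0 act_class /= /starts_at /= eqxx oner_eq0.
Qed.

(** Each ghost edge carries the indicator function of the states at its source to that of the states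
    at its range. *)
Lemma eval_ghost_path_cst (t : term E K) v p : is_path v p ->
  eval t (fun=> 1) = eval (Vert K v) (fun=> 1) ->
  eval (term_ghost_path t p) (fun=> 1) =
  eval (Vert K (path_range v p)) (fun=> 1).
Proof.
elim: p v t => [|e p IHp] v t //= [ev ep] tv; apply: IHp => //=.
rewrite tv -ev /=; apply: funext => y; case: ifP => // ye.
by have [/starts_withP[-> _ _] _] := starts_atP ye.
Qed.

(** Prescribed edges are absorbed into the empty sequence, so only the vertex and the integer
    change. *)
Lemma eval_ghost_path t v p f n : is_path v p ->
  (forall e, e \in p -> next (source e) = Some e) ->
  eval (term_ghost_path t p) f (path_range v p, [::], n) =
  eval t f (v, [::], n + \sum_(e <- p) weight e).
Proof.
elim: p v t => [|e p IHp] v t /=; first by rewrite big_nil addr0.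
move=> [<- ep] pnext.
rewrite /path_range /= -/(path_range _ _) IHp //; last first.
  by move=> e' e'p; apply: pnext; rewrite inE e'p orbT.
rewrite /= /starts_at /= eqxx /add_edge /= pnext ?mem_head // eqxx.
by rewrite big_cons -addrA (addrC (weight e)).
Qed.

Lemma cycle_not_regular v c : is_path v c -> path_range v c = v ->
  (forall e, e \in c -> next (source e) = Some e) ->
  \sum_(e <- c) weight e = 1 -> ~ vn_regular (@lpa_mul E K).
Proof.
move=> vc cv cnext c1 /(_ (lpa_vert K v - lpa_ghost_path K (v, c))) [x].
set a := _ - _ => axa.
have actB f y : act a f y = eval (Vert K v) f y -
    eval (term_ghost_path (Vert K v) c) f y.
  rewrite /a -scaleN1r -lpa_classZ -lpa_classD act_class /=.
  by rewrite mulN1r.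
have act_cst : act a (fun=> 1) = fun=> 0.
  apply: funext => y; rewrite actB.
  by rewrite (@eval_ghost_path_cst (Vert K v) v c vc erefl) cv subrr.
(* Going around [c] returns to the same state with the integer raised by its total weight 1. *)
have actv f : act a f (v, [::], 0) = f (v, [::], 0) - f (v, [::], 1).
  rewrite actB -[X in eval (term_ghost_path _ _) _ (X, _, _)]cv.
  by rewrite eval_ghost_path // c1 add0r /= /starts_at /= eqxx.
pose f (y : state) : K := y.2%:~R.
(* Shifting adds the constant 1 to [f], and [a] kills constants. *)
have af_shift : act a f \o shift = act a f.
  rewrite -eval_shift; have -> : f \o shift = fun y => f y + 1.
    by apply: funext => y; rewrite /f /= intrD.
  rewrite evalD; apply: funext => y.
  by rewrite -[eval _ (fun=> 1)]/(act a (fun=> 1)) act_cst addr0.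
have xaf_shift : act x (act a f) \o shift = act x (act a f).
  by rewrite -[LHS]eval_shift af_shift.
(* At this state [a ** x ** a] gives the difference of two equal values of a shift-invariant
   function, while [a] gives 0 - 1. *)
have := congr1 (fun b => act b f (v, [::], 0)) axa.
rewrite /= -lpa_mulA !actM !actv -[X in X _ - _]xaf_shift /= subrr.
move/eqP; rewrite /f /= sub0r eq_sym oppr_eq0 oner_eq0.
by [].
Qed.

End PathModule.

(** * Regularity excludes cycles *)

Section CycleNotRegular.
Variables (E : graph) (K : fieldType).

(** Distinct sources leave at most one edge of [c] to prescribe at each vertex. Elsewhere any
    emitted edge is chosen, and [None] is left for sinks. *)
Lemma next_edge_extending c : uniq (map (@source E) c) ->
  exists next : vertex E -> option (edge E),
  [/\ forall v e, next v = Some e -> source e = v,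
      forall v, next v = None -> is_sink v \/ infinite_emitter v
    & forall e, e \in c -> next (source e) = Some e].
Proof.
move=> c_uniq.
have /choice[next nextP] : forall v : vertex E, exists o : option (edge E),
  [/\ forall e, o = Some e -> source e = v,
      o = None -> is_sink v
    & forall e, e \in c -> source e = v -> o = Some e].
  move=> v.
  have [[e ec ev]|no_e] := pselect (exists2 e, e \in c & source e = v).
    exists (Some e); split=> // [e' [<-] //|e' e'c e'v].
    by congr Some; apply: (uniq_map_inj_in c_uniq) => //; rewrite ev.
  have [[e ev]|v_sink] := pselect (exists e, source e = v).
    exists (Some e); split=> // [e' [<-] //|e' e'c e'v].
    by case: no_e; exists e'.
  exists None; split=> // [_|e ec ev]; last by case: no_e; exists e.
  by apply/seteqP; split=> // e ev; apply: v_sink; exists e.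
exists next; split=> [v e|v|e ec].
- by have [+ _ _] := nextP v; apply.
- by have [_ + _] := nextP v => /[apply]; left.
- by have [_ _ +] := nextP (source e); apply.
Qed.

Lemma regular_acyclic : vn_regular (@lpa_mul E K) -> acyclic E.
Proof.
move=> reg v [|e c] [] // _ vc cv /NoDup_uniq c_uniq.
have [next [next_source next_None cnext]] := next_edge_extending c_uniq.
(* Only the first edge of the cycle has weight; it does not recur, the sources being distinct, so
   the total is 1. *)
pose weight (f : edge E) : int := (f == e)%:R.
apply: (cycle_not_regular (weight := weight) next_source next_None vc cv) => //.
rewrite big_cons /weight eqxx big_seq big1 ?addr0 // => f fc.
case: eqP => // fe; move: c_uniq; rewrite /= -fe => /andP[/negP[]].
exact: map_f.
Qed.

Lemma lpa_vert_neq0 (v : vertex E) : lpa_vert K v <> 0.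
Proof.
have [next [next_source next_None _]] := @next_edge_extending [::] isT.
exact: (act_vert_neq0 (fun=> 0) next_source next_None).
Qed.

End CycleNotRegular.

(** * From properness on the algebra to the field *)

Section ProperInvolution.
Variables (E : graph) (K : fieldType) (bar : K -> K).
Hypothesis bar_inv : is_involution *%R bar.
Local Notation L := (lpa E K).
Local Notation "x ** y" := (@lpa_mul E K x y) (at level 40, left associativity).
Local Notation path := (vertex E * seq (edge E))%type.
Local Notation st := (@lpa_star E K bar).
Local Notation pth := (@lpa_path E K).
Hypothesis acE : acyclic E.

(** Equal first edges cancel. When one path runs out, the product is zero unless the rest of the
    other starts at the common range; that rest is then closed, hence trivial by acyclicity. *)
Lemma star_path_path (p q : path) : is_path p.1 p.2 -> is_path q.1 q.2 ->
  path_range p.1 p.2 = path_range q.1 q.2 ->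
  st (pth p) ** pth q = if p == q then lpa_vert K (path_range p.1 p.2) else 0.
Proof.
case: p q => [v p] [w q] /=.
have vert_path v' w' r : is_path w' r -> v' = path_range w' r ->
    lpa_vert K v' ** pth (w', r) =
    if (v', [::]) == (w', r) then lpa_vert K v' else 0.
  move=> w'r v'E; rewrite -(lpa_vert_path K w'r) lpa_mulA lpa_vertM xpair_eqE.
  have [vw|_] := eqVneq v' w'; last by rewrite lpa_mul0r.
  rewrite {v'}vw in v'E *.
  rewrite (acyclic_closed_path acE w'r (esym v'E)) eqxx.
  by rewrite lpa_path_nil lpa_vertM eqxx.
elim: p q v w => [|e p IHp] [|f q] v w vp wq pq.
- by rewrite lpa_path_nil lpa_star_vert // vert_path.
- by rewrite lpa_path_nil lpa_star_vert // vert_path.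
- rewrite lpa_path_nil -(lpa_star_vert bar_inv w) -lpa_starM //.
  rewrite vert_path // eq_sym; case: eqP => [[-> ->]|_] //;
    last exact: lpa_star0.
  exact: lpa_star_vert.
- case: vp wq pq => <- vp [<- wq] pq; rewrite !lpa_path_cons lpa_starM //.
  have -> : forall x y z t : L, x ** y ** (z ** t) = x ** (y ** z) ** t.
    by move=> x y z t; rewrite !lpa_mulA.
  rewrite lpa_star_edge // lpa_ghost_edge.
  have [ef|ef] := eqVneq e f; last first.
    by rewrite !(lpa_mulr0, lpa_mul0r) xpair_eqE eqseq_cons (negPf ef) !andbF.
  rewrite -ef in wq pq *; rewrite -(lpa_mulA (st _)) lpa_vert_path //.
  by have := IHp q _ _ vp wq pq; rewrite !xpair_eqE eqseq_cons !eqxx.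
Qed.

Lemma proper_n_proper n : proper_involution (@lpa_mul E K) st ->
  (0 < n)%N -> le_sigma E n -> n_proper *%R bar n.
Proof.
move=> /proper_involutionP L_proper n_gt0 n_sigma k k0 i.
(* Otherwise n - 1 would bound the number of paths into every vertex, so sigma would be finite and
   at most n - 1. *)
have [w wn] : exists w : vertex E, ~ (paths_to w #<= `I_(n.-1))%card.
  apply/existsNP => n_bound; move: n_sigma; rewrite /le_sigma /sigma.
  case: pselect => [bounded|[]]; last by exists n.-1; apply/asboolP.
  case: ex_minnP => m _ /(_ n.-1 (asboolT n_bound)) mn.
  by move=> /leq_trans/(_ mn); rewrite -ltnS prednK // ltnn.
have [s [s_uniq + sw]] := card_gt_uniq_seq wn; rewrite prednK // => sn.
pose p (j : 'I_n) := nth (w, [::]) s j.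
have pw j : is_path (p j).1 (p j).2 /\ path_range (p j).1 (p j).2 = w.
  by apply: sw; rewrite mem_nth // sn.
have pp j l : st (pth (p j)) ** pth (p l) = if j == l then lpa_vert K w else 0.
  have [[pj jw] [pl lw]] := (pw j, pw l).
  rewrite star_path_path ?jw ?lw //; congr (if _ then _ else _).
  by rewrite nth_uniq ?sn.
pose x := \sum_j k j *: pth (p j).
have px : forall j, st (pth (p j)) ** x = k j *: lpa_vert K w.
  move=> j.
  rewrite lpa_mul_sumr (bigD1 j) //= lpa_scaleAr pp eqxx big1 ?addr0 // => l lj.
  by rewrite lpa_scaleAr pp eq_sym (negPf lj) scaler0.
have x0 : x = 0.
  apply: L_proper; rewrite {1}/x lpa_star_sum // lpa_mul_suml.
  rewrite (eq_bigr (fun j => (bar (k j) * k j) *: lpa_vert K w)) => [|j _].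
    by rewrite -scaler_suml k0 scale0r.
  by rewrite lpa_starZ // lpa_scaleAl px scalerA.
(* Multiplying [x = 0] by the adjoint of the path [p i] isolates [k i] times a vertex, and vertices
   are nonzero. *)
have /eqP := px i; rewrite x0 lpa_mulr0 eq_sym scaler_eq0 => /orP[/eqP //|/eqP].
by move/(@lpa_vert_neq0 E K w).
Qed.

End ProperInvolution.

Theorem theorem3p3 (E : graph) (K : fieldType) (bar : K -> K)
    (bar_inv : is_involution *%R bar) :
  let mul : lpa E K -> lpa E K -> lpa E K := lpa_mul in
  let star : lpa E K -> lpa E K := lpa_star bar in
  (star_regular mul star <-> vn_regular mul /\ proper_involution mul star) /\
  (vn_regular mul /\ proper_involution mul star <->
   acyclic E /\
   forall n : nat, (0 < n)%N -> le_sigma E n -> n_proper *%R bar n).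
Proof.
move=> mul star; have star_inv := lpa_star_involution E bar_inv.
split; split.
- exact: (star_regular_regular_proper (@lpa_mulA E K) (@lpa_mulDr E K)
    star_inv (@lpa_right_unit E K)).
- case; exact: (regular_proper_star_regular (@lpa_mulA E K) (@lpa_mulDl E K)
    (@lpa_mulDr E K) star_inv).
- move=> [reg L_proper]; have acE := regular_acyclic reg.
  by split=> // n; apply: (proper_n_proper bar_inv acE L_proper).
- move=> [acE K_proper]; split; first exact: acyclic_regular bar_inv acE.
  exact: acyclic_proper bar_inv acE K_proper.
Qed.
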